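(* Let $\mathcal{C}$ be a duoidal category with structure $(\circ,I,\bullet,J,\zeta,\delta,\varpi,\tau)$. Assume that $\mathcal{C}$ has coequalizers, that every object of $\mathcal{C}^\circ=(\mathcal{C},\circ,I)$ is coflat, and that $I$ is a left $\circ$-generator of $(\mathcal{C},\circ,I)$. Let $f_1:R_1\to S_1$ and $f_2:R_2\to S_2$ be morphisms of algebras in $\mathcal{C}^\circ$ such that $f_1^*=-\circ_{R_1}S_1:\mathcal{C}_{R_1}\to\mathcal{C}_{S_1}$ and $f_2^*=-\circ_{R_2}S_2:\mathcal{C}_{R_2}\to\mathcal{C}_{S_2}$ are semiseparable (resp., separable, naturally full). Then $(f_1\bullet f_2)^*=-\circ_{R_1\bullet R_2}(S_1\bullet S_2):\mathcal{C}_{R_1\bullet R_2}\to\mathcal{C}_{S_1\bullet S_2}$ is also semiseparable (resp., separable, naturally full).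
   Context: A duoidal category is a category $\mathcal{C}$ with two monoidal structures $\mathcal{C}^\circ=(\mathcal{C},\circ,I)$ and $\mathcal{C}^\bullet=(\mathcal{C},\bullet,J)$, a natural transformation $\zeta_{A,B,C,D}:(A\bullet B)\circ(C\bullet D)\to(A\circ C)\bullet(B\circ D)$ and morphisms $\delta:I\to I\bullet I$, $\varpi:J\circ J\to J$, $\tau:I\to J$ such that $(J,\varpi,\tau)$ is an algebra in $\mathcal{C}^\circ$, $(I,\delta,\tau)$ is a coalgebra in $\mathcal{C}^\bullet$, and (associativity constraints suppressed, composition written by juxtaposition, $l^\circ,r^\circ,l^\bullet,r^\bullet$ the unit constraints) $\zeta_{A,B,C\circ E,D\circ F}(\mathrm{Id}_{A\bullet B}\circ\zeta_{C,D,E,F})=\zeta_{A\circ C,B\circ D,E,F}(\zeta_{A,B,C,D}\circ\mathrm{Id}_{E\bullet F})$, $(\mathrm{Id}_{A\circ D}\bullet\zeta_{B,C,E,F})\zeta_{A,B\bullet C,D,E\bullet F}=(\zeta_{A,B,D,E}\bullet\mathrm{Id}_{C\circ F})\zeta_{A\bullet B,C,D\bullet E,F}$, $(l^\circ_A\bullet l^\circ_B)\zeta_{I,I,A,B}(\delta\circ\mathrm{Id}_{A\bullet B})=l^\circ_{A\bullet B}$, $(r^\circ_A\bullet r^\circ_B)\zeta_{A,B,I,I}(\mathrm{Id}_{A\bullet B}\circ\delta)=r^\circ_{A\bullet B}$, $l^\bullet_{A\circ B}(\varpi\bullet\mathrm{Id}_{A\circ B})\zeta_{J,A,J,B}=l^\bullet_A\circ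 l^\bullet_B$, $r^\bullet_{A\circ B}(\mathrm{Id}_{A\circ B}\bullet\varpi)\zeta_{A,J,B,J}=r^\bullet_A\circ r^\bullet_B$. For algebras $(A,m_A,u_A)$, $(B,m_B,u_B)$ in $\mathcal{C}^\circ$, $A\bullet B$ is an algebra in $\mathcal{C}^\circ$ with multiplication $(m_A\bullet m_B)\zeta_{A,B,A,B}$ and unit $(u_A\bullet u_B)\delta$; if $f_1,f_2$ are algebra morphisms in $\mathcal{C}^\circ$, so is $f_1\bullet f_2$. For an algebra $A$ in $\mathcal{C}^\circ$, $\mathcal{C}_A$ is the category of right $A$-modules in $\mathcal{C}^\circ$. An object $X$ of $\mathcal{C}^\circ$ is coflat if $X\circ-$ and $-\circ X$ preserve coequalizers. For a right $A$-module $(M,\nu)$ and a left $A$-module $(X,\mu)$ in $\mathcal{C}^\circ$, $q^A_{M,X}:M\circ X\to M\circ_A X$ is the coequalizer of $\nu\circ\mathrm{Id}_X$ and $\mathrm{Id}_M\circ\mu$. For an algebra morphism $f:R\to S$ in $\mathcal{C}^\circ$, $S$ is a left $R$-module via $m_S(f\circ\mathrm{Id}_S)$ and $f^*=-\circ_R S:\mathcal{C}_R\to\mathcal{C}_S$ sends $X$ to $X\circ_R S$ with right $S$-action induced by $m_S$, and $h:X\to Y$ to the unique morphism $h\circ_R S$ with $(h\circ_R S)q^R_{X,S}=q^R_{Y,S}(h\circ\mathrm{Id}_S)$. $I$ is a left $\circ$-generator if for any $f,g:Y\circ Z\to W$ with $f(\varepsilon\circ\mathrm{Id}_Z)=g(\varepsilon\circ\mathrm{Id}_Z)$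 for all $\varepsilon:I\to Y$, one has $f=g$. A functor $F:\mathcal{A}\to\mathcal{B}$ induces the natural transformation $\mathcal{F}:\mathrm{Hom}_{\mathcal{A}}(-,-)\to\mathrm{Hom}_{\mathcal{B}}(F-,F-)$, $f\mapsto F(f)$. $F$ is separable (resp. naturally full, semiseparable) if there is a natural transformation $\mathcal{P}:\mathrm{Hom}_{\mathcal{B}}(F-,F-)\to\mathrm{Hom}_{\mathcal{A}}(-,-)$ such that the composite of $\mathcal{F}$ followed by $\mathcal{P}$ is the identity (resp. $\mathcal{P}$ followed by $\mathcal{F}$ is the identity, $\mathcal{F}$ followed by $\mathcal{P}$ followed by $\mathcal{F}$ equals $\mathcal{F}$). *)

(* Defs.v *)
From Stdlib Require Import ssreflect ssrfun ProofIrrelevance ClassicalEpsilon.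

Set Implicit Arguments.
Unset Strict Implicit.
Unset Printing Implicit Defensive.

Declare Scope cat_scope.
Delimit Scope cat_scope with cat.
Local Open Scope cat_scope.

Record category := Category {
  ob :> Type;
  hom : ob -> ob -> Type;
  idm : forall A, hom A A;
  comp : forall A B D, hom B D -> hom A B -> hom A D;
  comp_idl : forall A B (f : hom A B), comp (idm B) f = f;
  comp_idr : forall A B (f : hom A B), comp f (idm A) = f;
  comp_assoc : forall A B D E (h : hom D E) (g : hom B D) (f : hom A B),
    comp h (comp g f) = comp (comp h g) f }.

Arguments hom {c} A B.
Arguments idm {c} A.
Arguments comp {c A B D} g f.
Notation "g \o f" := (comp g f) : cat_scope.

Record functor (C D : category) := Functor {
  fob :> C -> D;
  fmap : forall A B : C, hom A B -> hom (fob A) (fob B);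
  fmap_id : forall A : C, fmap (idm A) = idm (fob A);
  fmap_comp : forall (A B E : C) (g : hom B E) (f : hom A B),
    fmap (g \o f) = fmap g \o fmap f }.

Arguments fmap {C D} F {A B} f : rename.

(* [P] is a natural transformation [Hom_D(F -, F -) -> Hom_C(-, -)]. *)
Definition natural_on_homs (C D : category) (F : functor C D)
    (P : forall A B : C, hom (F A) (F B) -> hom A B) : Prop :=
  forall (A A' B B' : C) (h : hom A' A) (k : hom B B') (g : hom (F A) (F B)),
    P A' B' (fmap F k \o g \o fmap F h) = k \o P A B g \o h.

Definition separable (C D : category) (F : functor C D) : Prop :=
  exists P : forall A B : C, hom (F A) (F B) -> hom A B,
    natural_on_homs P /\
    forall (A B : C) (f : hom A B), P A B (fmap F f) = f.

Definition naturally_full (C D : category) (F : functor C D) : Prop :=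
  exists P : forall A B : C, hom (F A) (F B) -> hom A B,
    natural_on_homs P /\
    forall (A B : C) (g : hom (F A) (F B)), fmap F (P A B g) = g.

Definition semiseparable (C D : category) (F : functor C D) : Prop :=
  exists P : forall A B : C, hom (F A) (F B) -> hom A B,
    natural_on_homs P /\
    forall (A B : C) (f : hom A B), fmap F (P A B (fmap F f)) = fmap F f.

Definition is_coequalizer (C : category) (A B Q : C) (f g : hom A B)
    (q : hom B Q) : Prop :=
  q \o f = q \o g /\
  forall (T : C) (h : hom B T), h \o f = h \o g ->
    exists! k : hom Q T, k \o q = h.

Record coequalizer (C : category) (A B : C) (f g : hom A B) := Coequalizer {
  coeq_ob : C;
  coeq_map : hom B coeq_ob;
  coeq_ax : is_coequalizer f g coeq_map }.

(* A choice of a coequalizer for every parallel pair, rather than its mere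
   existence: the objects [M o_A X] are then determined on the nose. *)
Definition has_coequalizers (C : category) : Type :=
  forall (A B : C) (f g : hom A B), coequalizer f g.

Definition preserves_coequalizers (C D : category) (F : functor C D) : Prop :=
  forall (A B Q : C) (f g : hom A B) (q : hom B Q),
    is_coequalizer f g q -> is_coequalizer (fmap F f) (fmap F g) (fmap F q).

Section CoequalizerTheory.
Variables (C : category) (A B Q : C) (f g : hom A B) (q : hom B Q).
Hypothesis Hq : is_coequalizer f g q.

Definition coeq_factor (T : C) (h : hom B T) (Hh : h \o f = h \o g) : hom Q T :=
  proj1_sig (constructive_indefinite_description _ (proj2 Hq T h Hh)).

Lemma coeq_factorE (T : C) (h : hom B T) (Hh : h \o f = h \o g) :
  coeq_factor Hh \o q = h.
Proof.
exact: (proj1 (proj2_sig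
  (constructive_indefinite_description _ (proj2 Hq T h Hh)))).
Qed.

Lemma coeq_epi (T : C) (k k' : hom Q T) : k \o q = k' \o q -> k = k'.
Proof.
move=> E; have H : (k' \o q) \o f = (k' \o q) \o g.
  by rewrite -!comp_assoc (proj1 Hq).
case: (proj2 Hq T _ H) => k0 [_ U].
by rewrite -(U k E) -(U k' (eq_refl _)).
Qed.

End CoequalizerTheory.

(* Not assumed strict: the associators usually suppressed on paper appear
   explicitly here, in modules and in [duoidal] below. *)
Record monoidal (C : category) := Monoidal {
  tens : C -> C -> C;
  tens_hom : forall A A' B B' : C,
    hom A A' -> hom B B' -> hom (tens A B) (tens A' B');
  munit : C;
  assoc : forall A B D : C, hom (tens (tens A B) D) (tens A (tens B D));
  assoc_inv : forall A B D : C, hom (tens A (tens B D)) (tens (tens A B) D);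
  lunit : forall A : C, hom (tens munit A) A;
  lunit_inv : forall A : C, hom A (tens munit A);
  runit : forall A : C, hom (tens A munit) A;
  runit_inv : forall A : C, hom A (tens A munit);
  tens_id : forall A B : C, tens_hom (idm A) (idm B) = idm (tens A B);
  tens_comp : forall (A A' A'' B B' B'' : C)
    (f' : hom A' A'') (f : hom A A') (g' : hom B' B'') (g : hom B B'),
    tens_hom (f' \o f) (g' \o g) = tens_hom f' g' \o tens_hom f g;
  assoc_nat : forall (A A' B B' D D' : C)
    (f : hom A A') (g : hom B B') (h : hom D D'),
    assoc A' B' D' \o tens_hom (tens_hom f g) h =
    tens_hom f (tens_hom g h) \o assoc A B D;
  assocK : forall A B D : C, assoc_inv A B D \o assoc A B D = idm _;
  assoc_invK : forall A B D : C, assoc A B D \o assoc_inv A B D = idm _;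
  lunit_nat : forall (A A' : C) (f : hom A A'),
    lunit A' \o tens_hom (idm munit) f = f \o lunit A;
  lunitK : forall A : C, lunit_inv A \o lunit A = idm _;
  lunit_invK : forall A : C, lunit A \o lunit_inv A = idm _;
  runit_nat : forall (A A' : C) (f : hom A A'),
    runit A' \o tens_hom f (idm munit) = f \o runit A;
  runitK : forall A : C, runit_inv A \o runit A = idm _;
  runit_invK : forall A : C, runit A \o runit_inv A = idm _;
  pentagon : forall A B D E : C,
    assoc A B (tens D E) \o assoc (tens A B) D E =
    tens_hom (idm A) (assoc B D E) \o assoc A (tens B D) E
      \o tens_hom (assoc A B D) (idm E);
  triangle : forall A B : C,
    tens_hom (idm A) (lunit B) \o assoc A munit B =
    tens_hom (runit A) (idm B) }.

Arguments tens {C} V A B : rename.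
Arguments tens_hom {C} V {A A' B B'} f g : rename.
Arguments munit {C} V : rename.
Arguments assoc {C} V A B D : rename.
Arguments lunit {C} V A : rename.
Arguments runit {C} V A : rename.

Section MonoidalTheory.
Variables (C : category) (V : monoidal C).
Local Notation "A ⊗ B" := (tens V A B) (at level 40, left associativity).
Local Notation "f ⊠ g" := (tens_hom V f g) (at level 40, left associativity).

Lemma tens_split1 (A A' B B' : C) (f : hom A A') (g : hom B B') :
  (f ⊠ idm B') \o (idm A ⊠ g) = f ⊠ g.
Proof. by rewrite -tens_comp comp_idl comp_idr. Qed.

Lemma tens_split2 (A A' B B' : C) (f : hom A A') (g : hom B B') :
  (idm A' ⊠ g) \o (f ⊠ idm B) = f ⊠ g.
Proof. by rewrite -tens_comp comp_idl comp_idr. Qed.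

Lemma tens_compl (A A' A'' B : C) (f' : hom A' A'') (f : hom A A') :
  (f' \o f) ⊠ idm B = (f' ⊠ idm B) \o (f ⊠ idm B).
Proof. by rewrite -tens_comp comp_idl. Qed.

Lemma tens_compr (A B B' B'' : C) (g' : hom B' B'') (g : hom B B') :
  idm A ⊠ (g' \o g) = (idm A ⊠ g') \o (idm A ⊠ g).
Proof. by rewrite -tens_comp comp_idl. Qed.

Lemma assoc_inj (X A B D : C) (f g : hom X ((A ⊗ B) ⊗ D)) :
  assoc V A B D \o f = assoc V A B D \o g -> f = g.
Proof.
move=> E; rewrite -(comp_idl f) -(comp_idl g) -(assocK V A B D).
by rewrite -!comp_assoc E.
Qed.

Lemma runit_faithful (A B : C) (f g : hom A B) :
  f ⊠ idm (munit V) = g ⊠ idm (munit V) -> f = g.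
Proof.
move=> E; rewrite -(comp_idr f) -(comp_idr g) -(runit_invK V A) !comp_assoc.
by rewrite -!runit_nat E.
Qed.

Lemma runit_tens (A B : C) :
  (idm A ⊠ runit V B) \o assoc V A B (munit V) = runit V (A ⊗ B).
Proof.
apply: runit_faithful; apply: assoc_inj.
rewrite tens_compl comp_assoc assoc_nat -(triangle V B) tens_compr.
rewrite -!comp_assoc (comp_assoc (idm A ⊠ assoc _ _ _ _)) -pentagon.
by rewrite comp_assoc -assoc_nat tens_id -comp_assoc triangle.
Qed.

Definition tens_left (X : C) : functor C C.
Proof.
refine (@Functor C C (fun Y => X ⊗ Y) (fun Y Z h => idm X ⊠ h) _ _).
- by move=> Y; rewrite tens_id.
- by move=> Y Z T g f; rewrite tens_compr.
Defined.

Definition tens_right (X : C) : functor C C.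
Proof.
refine (@Functor C C (fun Y => Y ⊗ X) (fun Y Z h => h ⊠ idm X) _ _).
- by move=> Y; rewrite tens_id.
- by move=> Y Z T g f; rewrite tens_compl.
Defined.

Definition coflat (X : C) : Prop :=
  preserves_coequalizers (tens_left X) /\ preserves_coequalizers (tens_right X).

Definition unit_left_generator : Prop :=
  forall (Y Z W : C) (f g : hom (Y ⊗ Z) W),
    (forall e : hom (munit V) Y, f \o (e ⊠ idm Z) = g \o (e ⊠ idm Z)) -> f = g.

Definition is_algebra (A : C) (m : hom (A ⊗ A) A) (u : hom (munit V) A) : Prop :=
  m \o (m ⊠ idm A) = m \o (idm A ⊠ m) \o assoc V A A A /\
  m \o (u ⊠ idm A) = lunit V A /\
  m \o (idm A ⊠ u) = runit V A.

Definition is_coalgebra (A : C) (d : hom A (A ⊗ A)) (e : hom A (munit V)) : Prop :=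
  assoc V A A A \o (d ⊠ idm A) \o d = (idm A ⊠ d) \o d /\
  lunit V A \o (e ⊠ idm A) \o d = idm A /\
  runit V A \o (idm A ⊠ e) \o d = idm A.

Record algebra := Algebra {
  alg_ob :> C;
  alg_mul : hom (alg_ob ⊗ alg_ob) alg_ob;
  alg_unit : hom (munit V) alg_ob;
  alg_ax : is_algebra alg_mul alg_unit }.

Record alg_hom (R S : algebra) := AlgHom {
  alg_map :> hom R S;
  alg_map_mul : alg_map \o alg_mul R = alg_mul S \o (alg_map ⊠ alg_map);
  alg_map_unit : alg_map \o alg_unit R = alg_unit S }.

Record rmodule (A : algebra) := RModule {
  rmod_ob :> C;
  rmod_act : hom (rmod_ob ⊗ A) rmod_ob;
  rmod_mul : rmod_act \o (rmod_act ⊠ idm A) =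
    rmod_act \o (idm rmod_ob ⊠ alg_mul A) \o assoc V rmod_ob A A;
  rmod_unit : rmod_act \o (idm rmod_ob ⊠ alg_unit A) = runit V rmod_ob }.

Record lmodule (A : algebra) := LModule {
  lmod_ob :> C;
  lmod_act : hom (A ⊗ lmod_ob) lmod_ob;
  lmod_mul : lmod_act \o (alg_mul A ⊠ idm lmod_ob) =
    lmod_act \o (idm A ⊠ lmod_act) \o assoc V A A lmod_ob;
  lmod_unit : lmod_act \o (alg_unit A ⊠ idm lmod_ob) = lunit V lmod_ob }.

Record rmod_hom (A : algebra) (M N : rmodule A) := RModHom {
  rmod_map :> hom M N;
  rmod_map_lin : rmod_map \o rmod_act M = rmod_act N \o (rmod_map ⊠ idm A) }.

Lemma rmod_hom_eq (A : algebra) (M N : rmodule A) (f g : rmod_hom M N) :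
  rmod_map f = rmod_map g -> f = g.
Proof.
case: f g => [f Hf] [g Hg] /= E; rewrite -E in Hg *.
by rewrite (proof_irrelevance _ Hf Hg).
Qed.

Definition rmod_id (A : algebra) (M : rmodule A) : rmod_hom M M.
Proof. by exists (idm M); rewrite tens_id comp_idl comp_idr. Defined.

Definition rmod_comp (A : algebra) (M N P : rmodule A) (g : rmod_hom N P)
  (f : rmod_hom M N) : rmod_hom M P.
Proof.
exists (rmod_map g \o rmod_map f).
by rewrite -comp_assoc rmod_map_lin comp_assoc rmod_map_lin -comp_assoc tens_compl.
Defined.

Definition rmodules (A : algebra) : category.
Proof.
refine (@Category (rmodule A) (@rmod_hom A) (@rmod_id A) (@rmod_comp A) _ _ _).
- by move=> M N f; apply: rmod_hom_eq; rewrite /= comp_idl.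
- by move=> M N f; apply: rmod_hom_eq; rewrite /= comp_idr.
- by move=> M N P Q h g f; apply: rmod_hom_eq; rewrite /= comp_assoc.
Defined.

Definition restricted_lmodule (R S : algebra) (f : alg_hom R S) : lmodule R.
Proof.
exists (alg_ob S) (alg_mul S \o (alg_map f ⊠ idm S)).
- rewrite -comp_assoc -tens_compl alg_map_mul tens_compl comp_assoc.
  rewrite (proj1 (alg_ax S)) -!comp_assoc; congr (_ \o _).
  rewrite assoc_nat comp_assoc -tens_comp comp_idl.
  by rewrite comp_assoc tens_split1.
- rewrite -comp_assoc -tens_compl alg_map_unit.
  exact: (proj1 (proj2 (alg_ax S))).
Defined.

Variable coeqs : has_coequalizers C.

(* The middle action [M o (A o X) -> M o X] is precomposed with the associator,
   so that both arrows start from [(M o A) o X]. *)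
Definition tens_over_coeq (A : algebra) (M : rmodule A) (X : lmodule A) :
    coequalizer (rmod_act M ⊠ idm X)
                ((idm M ⊠ lmod_act X) \o assoc V M A X) :=
  coeqs _ _.

Definition tens_over (A : algebra) (M : rmodule A) (X : lmodule A) : C :=
  coeq_ob (tens_over_coeq M X).

Definition tens_over_proj (A : algebra) (M : rmodule A) (X : lmodule A) :
    hom (M ⊗ X) (tens_over M X) :=
  coeq_map (tens_over_coeq M X).

Section ExtensionOfScalars.
Hypothesis all_coflat : forall X : C, coflat X.
Variables (R S : algebra) (f : alg_hom R S).
Local Notation fS := (restricted_lmodule f).

Section Object.
Variable X : rmodule R.
Local Notation q := (tens_over_proj X fS).

Lemma ext_proj_coeq : is_coequalizer (rmod_act X ⊠ idm S)
  ((idm X ⊠ (alg_mul S \o (alg_map f ⊠ idm S))) \o assoc V X R S) q.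
Proof. exact: (coeq_ax (tens_over_coeq X fS)). Qed.

Lemma ext_proj_balanced : q \o (rmod_act X ⊠ idm S) =
  q \o ((idm X ⊠ (alg_mul S \o (alg_map f ⊠ idm S))) \o assoc V X R S).
Proof. exact: (proj1 ext_proj_coeq). Qed.

Lemma ext_proj_tens_coeq (Y : C) :
  is_coequalizer ((rmod_act X ⊠ idm S) ⊠ idm Y)
  (((idm X ⊠ (alg_mul S \o (alg_map f ⊠ idm S))) \o assoc V X R S) ⊠ idm Y)
  (q ⊠ idm Y).
Proof. exact: (proj2 (all_coflat Y) _ _ _ _ _ _ ext_proj_coeq). Qed.

(* [ext_act0] is the map that descends along [q o Id_S] to the right S-action
   on [X o_R S]; [S] being coflat, [q o Id_S] is again a coequalizer. *)
Definition ext_act0 : hom ((X ⊗ S) ⊗ S) (tens_over X fS) :=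
  q \o (idm X ⊠ alg_mul S) \o assoc V X S S.

Lemma ext_act0_balanced :
  ext_act0 \o ((rmod_act X ⊠ idm S) ⊠ idm S) =
  ext_act0 \o (((idm X ⊠ (alg_mul S \o (alg_map f ⊠ idm S)))
                  \o assoc V X R S) ⊠ idm S).
Proof.
have E : alg_mul S \o ((alg_mul S \o (alg_map f ⊠ idm S)) ⊠ idm S) =
    (alg_mul S \o (alg_map f ⊠ idm S)) \o (idm R ⊠ alg_mul S) \o assoc V R S S.
  rewrite tens_compl comp_assoc (proj1 (alg_ax S)) -!comp_assoc.
  congr (_ \o _); rewrite assoc_nat tens_id !comp_assoc.
  by rewrite tens_split1 tens_split2.
rewrite /ext_act0 tens_compl -!comp_assoc assoc_nat tens_id.
rewrite (comp_assoc (assoc V X S S) (_ ⊠ idm S)) assoc_nat.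
rewrite (comp_assoc (idm X ⊠ alg_mul S) (rmod_act X ⊠ _)) tens_split2.
rewrite -[in LHS]tens_split1 (comp_assoc _ _ (assoc _ _ _ _)).
rewrite (comp_assoc q) (comp_assoc q) ext_proj_balanced.
rewrite !comp_assoc -(comp_assoc q (idm X ⊠ alg_mul S)) -tens_compr E.
rewrite -!comp_assoc; congr (_ \o _).
rewrite (comp_assoc (assoc V X R S) (idm (X ⊗ R) ⊠ _)) -tens_id assoc_nat.
by rewrite -!comp_assoc pentagon !comp_assoc !tens_compr.
Qed.

Definition ext_act : hom (tens_over X fS ⊗ S) (tens_over X fS) :=
  coeq_factor (ext_proj_tens_coeq S) ext_act0_balanced.

Lemma ext_actE :
  ext_act \o (q ⊠ idm S) = q \o (idm X ⊠ alg_mul S) \o assoc V X S S.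
Proof. exact: coeq_factorE. Qed.

Lemma ext_act_mul : ext_act \o (ext_act ⊠ idm S) =
  ext_act \o (idm (tens_over X fS) ⊠ alg_mul S) \o assoc V (tens_over X fS) S S.
Proof.
apply: (coeq_epi (proj2 (all_coflat S) _ _ _ _ _ _ (ext_proj_tens_coeq S))).
rewrite /= -!comp_assoc -tens_compl ext_actE assoc_nat tens_id.
rewrite (comp_assoc (idm _ ⊠ alg_mul S) (q ⊠ _)) tens_split2.
rewrite -[in RHS]tens_split1 !tens_compl !comp_assoc ext_actE.
rewrite -!comp_assoc; congr (_ \o _).
rewrite (comp_assoc (assoc V X S S) (idm (X ⊗ S) ⊠ _)) -tens_id assoc_nat.
rewrite (comp_assoc (assoc V X S S) (_ ⊠ idm S)) assoc_nat.
rewrite -!comp_assoc pentagon !comp_assoc -!tens_compr.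
by rewrite (proj1 (alg_ax S)) !tens_compr.
Qed.

Lemma ext_act_unit : ext_act \o (idm (tens_over X fS) ⊠ alg_unit S) =
  runit V (tens_over X fS).
Proof.
apply: (coeq_epi (ext_proj_tens_coeq (munit V))).
rewrite runit_nat -comp_assoc tens_split2 -tens_split1 comp_assoc ext_actE.
rewrite -!comp_assoc -tens_id assoc_nat (comp_assoc (idm X ⊠ alg_mul S)).
by rewrite -tens_compr (proj2 (proj2 (alg_ax S))) runit_tens.
Qed.

Definition ext_ob : rmodule S := RModule ext_act_mul ext_act_unit.

End Object.

Section Morphism.
Variables (X Y : rmodule R) (h : rmod_hom X Y).
Local Notation q M := (tens_over_proj M fS).

Lemma ext_map_balanced :
  q Y \o (rmod_map h ⊠ idm S) \o (rmod_act X ⊠ idm S) =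
  q Y \o (rmod_map h ⊠ idm S) \o
    ((idm X ⊠ (alg_mul S \o (alg_map f ⊠ idm S))) \o assoc V X R S).
Proof.
rewrite -comp_assoc -tens_compl rmod_map_lin tens_compl !comp_assoc.
rewrite ext_proj_balanced -!comp_assoc; congr (_ \o _).
by rewrite assoc_nat tens_id !comp_assoc tens_split1 tens_split2.
Qed.

Definition ext_map : hom (tens_over X fS) (tens_over Y fS) :=
  coeq_factor (ext_proj_coeq X) ext_map_balanced.

Lemma ext_mapE : ext_map \o q X = q Y \o (rmod_map h ⊠ idm S).
Proof. exact: coeq_factorE. Qed.

Lemma ext_map_lin : ext_map \o ext_act X = ext_act Y \o (ext_map ⊠ idm S).
Proof.
apply: (coeq_epi (ext_proj_tens_coeq X S)).
rewrite -!comp_assoc -tens_compl ext_actE ext_mapE tens_compl !comp_assoc.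
rewrite ext_mapE ext_actE -!comp_assoc; congr (_ \o _).
by rewrite assoc_nat tens_id !comp_assoc tens_split1 tens_split2.
Qed.

Definition ext_hom : rmod_hom (ext_ob X) (ext_ob Y) :=
  @RModHom S (ext_ob X) (ext_ob Y) ext_map ext_map_lin.

End Morphism.

(* The functor [f^* = - o_R S : C_R -> C_S]. *)
Definition extension_of_scalars : functor (rmodules R) (rmodules S).
Proof.
refine (@Functor (rmodules R) (rmodules S) ext_ob ext_hom _ _).
- move=> X; apply: rmod_hom_eq; apply: (coeq_epi (ext_proj_coeq X)).
  by rewrite /= ext_mapE tens_id comp_idl comp_idr.
- move=> X Y Z g h; apply: rmod_hom_eq; apply: (coeq_epi (ext_proj_coeq X)).
  by rewrite /= ext_mapE -comp_assoc ext_mapE comp_assoc ext_mapE tens_compl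
    comp_assoc.
Defined.

End ExtensionOfScalars.
End MonoidalTheory.

Section Duoidal.
Variables (C : category) (Vo Vb : monoidal C).
Local Notation I := (munit Vo).
Local Notation J := (munit Vb).
Local Notation "A ∘ B" := (tens Vo A B) (at level 40, left associativity).
Local Notation "A • B" := (tens Vb A B) (at level 40, left associativity).
Local Notation "f ∘₁ g" := (tens_hom Vo f g) (at level 40, left associativity).
Local Notation "f •₁ g" := (tens_hom Vb f g) (at level 40, left associativity).

Record duoidal := Duoidal {
  zeta : forall A B D E : C, hom ((A • B) ∘ (D • E)) ((A ∘ D) • (B ∘ E));
  delta : hom I (I • I);
  varpi : hom (J ∘ J) J;
  tau : hom I J;
  zeta_nat : forall (A A' B B' D D' E E' : C)
    (f : hom A A') (g : hom B B') (h : hom D D') (k : hom E E'),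
    zeta A' B' D' E' \o ((f •₁ g) ∘₁ (h •₁ k)) =
    ((f ∘₁ h) •₁ (g ∘₁ k)) \o zeta A B D E;
  J_algebra : is_algebra (V := Vo) varpi tau;
  I_coalgebra : is_coalgebra (V := Vb) delta tau;
  zeta_assoc_circ : forall A B D E F G : C,
    zeta A B (D ∘ F) (E ∘ G) \o (idm (A • B) ∘₁ zeta D E F G)
      \o assoc Vo (A • B) (D • E) (F • G) =
    (assoc Vo A D F •₁ assoc Vo B E G)
      \o zeta (A ∘ D) (B ∘ E) F G \o (zeta A B D E ∘₁ idm (F • G));
  zeta_assoc_bullet : forall A B D E F G : C,
    (idm (A ∘ E) •₁ zeta B D F G) \o zeta A (B • D) E (F • G)
      \o (assoc Vb A B D ∘₁ assoc Vb E F G) =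
    assoc Vb (A ∘ E) (B ∘ F) (D ∘ G)
      \o (zeta A B E F •₁ idm (D ∘ G)) \o zeta (A • B) D (E • F) G;
  delta_lunit : forall A B : C,
    (lunit Vo A •₁ lunit Vo B) \o zeta I I A B \o (delta ∘₁ idm (A • B)) =
    lunit Vo (A • B);
  delta_runit : forall A B : C,
    (runit Vo A •₁ runit Vo B) \o zeta A B I I \o (idm (A • B) ∘₁ delta) =
    runit Vo (A • B);
  varpi_lunit : forall A B : C,
    lunit Vb (A ∘ B) \o (varpi •₁ idm (A ∘ B)) \o zeta J A J B =
    lunit Vb A ∘₁ lunit Vb B;
  varpi_runit : forall A B : C,
    runit Vb (A ∘ B) \o (idm (A ∘ B) •₁ varpi) \o zeta A J B J =
    runit Vb A ∘₁ runit Vb B }.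

Variable D : duoidal.

Definition bullet_mul (A B : algebra Vo) : hom ((A • B) ∘ (A • B)) (A • B) :=
  (alg_mul A •₁ alg_mul B) \o zeta D A B A B.

Definition bullet_unit (A B : algebra Vo) : hom I (A • B) :=
  (alg_unit A •₁ alg_unit B) \o delta D.

Lemma bullet_is_algebra (A B : algebra Vo) :
  is_algebra (V := Vo) (bullet_mul A B) (bullet_unit A B).
Proof.
case: (alg_ax A) => aA [lA rA]; case: (alg_ax B) => aB [lB rB].
rewrite /bullet_mul /bullet_unit; split; [|split].
- rewrite tens_compl tens_compr -!comp_assoc.
  rewrite (comp_assoc (zeta D A B A B) (_ ∘₁ idm _)) -(tens_id Vb) zeta_nat.
  rewrite (comp_assoc (zeta D A B A B) (_ ∘₁ _)) zeta_nat !comp_assoc.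
  rewrite -!tens_comp aA aB !tens_comp -!comp_assoc tens_id.
  rewrite (comp_assoc (assoc Vo _ _ _ •₁ assoc Vo _ _ _)) -zeta_assoc_circ.
  by rewrite -!comp_assoc.
- rewrite tens_compl -!comp_assoc.
  rewrite (comp_assoc (zeta D A B A B)) -(tens_id Vb) zeta_nat !comp_assoc.
  by rewrite -tens_comp lA lB tens_id delta_lunit.
- rewrite tens_compr -!comp_assoc.
  rewrite (comp_assoc (zeta D A B A B)) -(tens_id Vb) zeta_nat !comp_assoc.
  by rewrite -tens_comp rA rB tens_id delta_runit.
Qed.

Definition bullet_algebra (A B : algebra Vo) : algebra Vo :=
  Algebra (bullet_is_algebra A B).

Definition bullet_alg_hom (R1 S1 R2 S2 : algebra Vo)
  (f1 : alg_hom R1 S1) (f2 : alg_hom R2 S2) :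
  alg_hom (bullet_algebra R1 R2) (bullet_algebra S1 S2).
Proof.
exists (alg_map f1 •₁ alg_map f2).
- rewrite /= /bullet_mul comp_assoc -tens_comp !alg_map_mul tens_comp.
  by rewrite -!comp_assoc zeta_nat.
- by rewrite /= /bullet_unit comp_assoc -tens_comp !alg_map_unit.
Defined.

End Duoidal.

(* Main.v *)
(* An extension of scalars f^* is separable, naturally full or semiseparable
   iff there is an R-bimodule map E : S -> R with E f = id, f E = id or
   f E f = f respectively.  Given E, a map g : X o_R S -> Y o_R S is sent to
   X -> X o_R S -> Y o_R S -> Y, the last map being induced by E.  Conversely,
   if P is natural on homs, E is the image under P of the multiplication
   S o_R S -> S = R o_R S, viewed as a map f^*(S) -> f^*(R): it is right
   R-linear by construction, and naturality in the left multiplications by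
   elements I -> R gives left linearity, because I is a left generator.
   By naturality of zeta, the bullet product of two such bimodule maps is
   again one, and the identities above are preserved. *)

From Stdlib Require Import ssreflect.
Require Import Defs.

Set Implicit Arguments.
Unset Strict Implicit.
Unset Printing Implicit Defensive.

Local Open Scope cat_scope.

(** * Cancellation and rewriting in a category *)

Section Category.
Variable C : category.

(** Composites are bracketed to the left, so an equation for [g \o f] has to be applied below an
    outer factor [k]. *)
Lemma comp_reassoc (A B D E : C) (g : hom B D) (f : hom A B) (h : hom A D)
  (k : hom D E) : g \o f = h -> k \o g \o f = k \o h.
Proof. by move=> <-; rewrite comp_assoc. Qed.

Lemma split_epi (A B D : C) (p : hom A B) (s : hom B A) (f g : hom B D) :
  p \o s = idm B -> f \o p = g \o p -> f = g.
Proof.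
by move=> ps E; rewrite -(comp_idr f) -(comp_idr g) -ps !comp_assoc E.
Qed.

End Category.

(** * Coherence and naturality of the unit constraints *)

Section Monoidal.
Variables (C : category) (V : monoidal C).
Local Notation "A ⊗ B" := (tens V A B) (at level 40, left associativity).
Local Notation "f ⊠ g" := (tens_hom V f g) (at level 40, left associativity).
Local Notation I := (munit V).

Lemma lunit_faithful (A B : C) (f g : hom A B) :
  idm I ⊠ f = idm I ⊠ g -> f = g.
Proof.
by move=> E; apply: (split_epi (lunit_invK V A)); rewrite -!lunit_nat E.
Qed.

(** Kelly's argument: after tensoring with [I] on the left and precomposing with two invertible
    associators, the pentagon and two uses of the triangle suffice. *)
Lemma lunit_tens (A B : C) :
  lunit V (A ⊗ B) \o assoc V I A B = lunit V A ⊠ idm B.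
Proof.
apply: lunit_faithful.
have K1 : (assoc V I I A ⊠ idm B) \o (assoc_inv V I I A ⊠ idm B) = idm _.
  by rewrite -tens_compl assoc_invK tens_id.
apply: (split_epi (assoc_invK V I (I ⊗ A) B)); apply: (split_epi K1).
rewrite tens_compr -!comp_assoc (comp_assoc (idm I ⊠ assoc _ _ _ _)) -pentagon.
rewrite comp_assoc triangle -(tens_id V A B) -assoc_nat -triangle tens_compl.
by rewrite comp_assoc assoc_nat -comp_assoc.
Qed.

Lemma lunit_inv_nat (A B : C) (f : hom A B) :
  lunit_inv V B \o f = (idm I ⊠ f) \o lunit_inv V A.
Proof.
apply: (split_epi (lunit_invK V A)).
by rewrite -!comp_assoc lunitK comp_idr -lunit_nat comp_assoc lunitK comp_idl.
Qed.

Lemma lunit_inv_tens (A B : C) :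
  assoc V I A B \o (lunit_inv V A ⊠ idm B) = lunit_inv V (A ⊗ B).
Proof.
rewrite -(comp_idl (_ \o _)) -(lunitK V (A ⊗ B)) -comp_assoc (comp_assoc (lunit _ _)).
by rewrite lunit_tens -tens_compl lunit_invK tens_id comp_idr.
Qed.

Lemma runit_inv_nat (A B : C) (f : hom A B) :
  runit_inv V B \o f = (f ⊠ idm I) \o runit_inv V A.
Proof.
apply: (split_epi (runit_invK V A)).
by rewrite -!comp_assoc runitK comp_idr -runit_nat comp_assoc runitK comp_idl.
Qed.

Lemma tens_interchange (A A' B B' : C) (f : hom A A') (g : hom B B') :
  (idm A' ⊠ g) \o (f ⊠ idm B) = (f ⊠ idm B') \o (idm A ⊠ g).
Proof. by rewrite tens_split1 tens_split2. Qed.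

Lemma tens_comp_reassoc (A A' A'' B B' B'' D : C) (k : hom (A'' ⊗ B'') D)
    (f' : hom A' A'') (f : hom A A') (g' : hom B' B'') (g : hom B B') :
  k \o (f' ⊠ g') \o (f ⊠ g) = k \o ((f' \o f) ⊠ (g' \o g)).
Proof. by rewrite -comp_assoc -tens_comp. Qed.

Lemma assoc_nat_reassoc (A A' B B' D D' E : C) (k : hom (A' ⊗ (B' ⊗ D')) E)
    (f : hom A A') (g : hom B B') (h : hom D D') :
  k \o assoc V A' B' D' \o ((f ⊠ g) ⊠ h) =
  k \o (f ⊠ (g ⊠ h)) \o assoc V A B D.
Proof. by rewrite -!comp_assoc assoc_nat. Qed.

Definition tens_fuse := (tens_comp_reassoc, comp_idl, comp_idr).

(** * Algebras as right modules over themselves; left multiplications *)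

Section Modules.
Variable A : algebra V.

Lemma alg_mul_assoc :
  alg_mul A \o (alg_mul A ⊠ idm A) =
  alg_mul A \o (idm A ⊠ alg_mul A) \o assoc V A A A.
Proof. exact: proj1 (alg_ax A). Qed.

Lemma alg_mul_unitl : alg_mul A \o (alg_unit A ⊠ idm A) = lunit V A.
Proof. exact: proj1 (proj2 (alg_ax A)). Qed.

Lemma alg_mul_unitr : alg_mul A \o (idm A ⊠ alg_unit A) = runit V A.
Proof. exact: proj2 (proj2 (alg_ax A)). Qed.

(** Inserting the unit of [A] in the second factor recovers [h] up to the right unit constraint. *)
Lemma alg_mul_faithful (X : C) (h k : hom X A) :
  alg_mul A \o (h ⊠ idm A) = alg_mul A \o (k ⊠ idm A) -> h = k.
Proof.
have E (l : hom X A) :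
    alg_mul A \o (l ⊠ idm A) \o (idm X ⊠ alg_unit A) = l \o runit V X.
  by rewrite -comp_assoc -tens_interchange comp_assoc alg_mul_unitr runit_nat.
by move=> hk; apply: (split_epi (runit_invK V X)); rewrite -!E hk.
Qed.

Definition regular_rmodule : rmodule A := RModule alg_mul_assoc alg_mul_unitr.

(** Maps [e : I -> A] play the role of elements of [A]; the generator hypothesis tests on them. *)
Definition left_mul (e : hom I A) : hom A A :=
  alg_mul A \o (e ⊠ idm A) \o lunit_inv V A.

Lemma left_mulE (e : hom I A) :
  left_mul e \o lunit V A = alg_mul A \o (e ⊠ idm A).
Proof. by rewrite /left_mul -comp_assoc lunitK comp_idr. Qed.

Lemma left_mul_lin (e : hom I A) :
  left_mul e \o alg_mul A = alg_mul A \o (left_mul e ⊠ idm A).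
Proof.
apply: (split_epi (lunit_invK V (A ⊗ A))); apply: (split_epi (assoc_invK V I A A)).
rewrite -[in RHS](comp_assoc _ (lunit _ _)) lunit_tens -[in RHS]comp_assoc.
rewrite -tens_compl left_mulE tens_compl comp_assoc alg_mul_assoc.
rewrite -[in RHS]comp_assoc assoc_nat comp_assoc; congr (_ \o _).
rewrite -(comp_assoc _ (alg_mul A)) -lunit_nat comp_assoc left_mulE.
rewrite (comp_reassoc _ (tens_split1 _ _ _)) tens_id.
by rewrite (comp_reassoc _ (tens_split2 _ _ _)).
Qed.

Definition left_mul_hom (e : hom I A) : rmod_hom regular_rmodule regular_rmodule :=
  @RModHom C V A regular_rmodule regular_rmodule _ (left_mul_lin e).

End Modules.
End Monoidal.

(** * Restriction of scalars and the unit map into [X o_R S] *)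

Section Extension.
Variables (C : category) (V : monoidal C).
Local Notation "A ⊗ B" := (tens V A B) (at level 40, left associativity).
Local Notation "f ⊠ g" := (tens_hom V f g) (at level 40, left associativity).
Local Notation I := (munit V).
Variables (coeqs : has_coequalizers C) (all_coflat : forall X : C, coflat V X).
Variables (R S : algebra V) (f : alg_hom R S).
Local Notation F := (extension_of_scalars coeqs all_coflat f).
Local Notation q X := (tens_over_proj coeqs X (restricted_lmodule f)).

Lemma restrict_mul (M : rmodule S) (act := rmod_act M \o (idm M ⊠ f)) :
  act \o (act ⊠ idm R) = act \o (idm M ⊠ alg_mul R) \o assoc V M R R.
Proof.
have E : (rmod_act M \o (idm M ⊠ f)) ⊠ alg_map f =
    (rmod_act M ⊠ idm S) \o ((idm M ⊠ f) ⊠ f) by rewrite -tens_comp comp_idl.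
by rewrite /act !tens_fuse alg_map_mul E comp_assoc rmod_mul assoc_nat_reassoc !tens_fuse.
Qed.

Lemma restrict_unit (M : rmodule S) :
  rmod_act M \o (idm M ⊠ f) \o (idm M ⊠ alg_unit R) = runit V M.
Proof. by rewrite !tens_fuse alg_map_unit rmod_unit. Qed.

Definition restrict (M : rmodule S) : rmodule R :=
  RModule (@restrict_mul M) (restrict_unit M).

Lemma restrict_lin (M N : rmodule S) (h : rmod_hom M N) :
  rmod_map h \o rmod_act (restrict M) = rmod_act (restrict N) \o (h ⊠ idm R).
Proof. by rewrite /= comp_assoc rmod_map_lin !tens_fuse. Qed.

Definition restrict_hom (M N : rmodule S) (h : rmod_hom M N) :
    rmod_hom (restrict M) (restrict N) :=
  @RModHom C V R (restrict M) (restrict N) _ (restrict_lin h).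

Lemma ext_proj_balancedE (X : rmodule R) :
  q X \o (rmod_act X ⊠ idm S) =
  q X \o (idm X ⊠ (alg_mul S \o (f ⊠ idm S))) \o assoc V X R S.
Proof. by rewrite ext_proj_balanced comp_assoc. Qed.

Lemma balanced_proj (X : rmodule R) (T : C) (h : hom (X ⊗ S) T) :
  h \o (rmod_act X ⊠ idm S) =
    h \o (idm X ⊠ (alg_mul S \o (f ⊠ idm S))) \o assoc V X R S ->
  exists k : hom (tens_over coeqs X (restricted_lmodule f)) T, k \o q X = h.
Proof.
rewrite -(comp_assoc h) => E; case: (proj2 (ext_proj_coeq coeqs f X) T h E).
by move=> k [kE _]; exists k.
Qed.

(** The unit [x |-> x ⊗ 1] of the adjunction between [f^*] and restriction. *)
Definition ext_unit (X : rmodule R) :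
    hom X (tens_over coeqs X (restricted_lmodule f)) :=
  q X \o (idm X ⊠ alg_unit S) \o runit_inv V X.

Lemma ext_act_unitl (X : rmodule R) :
  ext_act coeqs all_coflat f X \o (ext_unit X ⊠ idm S) = q X.
Proof.
rewrite /ext_unit !tens_compl !comp_assoc ext_actE assoc_nat_reassoc !tens_fuse.
rewrite alg_mul_unitl -(comp_assoc (q X)) triangle -comp_assoc -tens_compl.
by rewrite runit_invK tens_id comp_idr.
Qed.

(** In elements, [x r ⊗ 1 = x ⊗ f(r) 1 = x ⊗ f(r) = (x ⊗ 1) f(r)]. *)
Lemma ext_unit_lin (X : rmodule R) :
  ext_unit X \o rmod_act X =
  rmod_act (restrict (ext_ob coeqs all_coflat f X)) \o (ext_unit X ⊠ idm R).
Proof.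
rewrite /= !tens_fuse -(tens_split1 _ (ext_unit X)) comp_assoc ext_act_unitl.
rewrite /ext_unit -comp_assoc runit_inv_nat comp_assoc.
rewrite -(comp_assoc (q X)) tens_interchange comp_assoc ext_proj_balancedE.
rewrite -(tens_id V X R) assoc_nat_reassoc !tens_fuse -comp_assoc.
have -> : alg_mul S \o (alg_map f ⊠ alg_unit S) = f \o runit V R.
  by rewrite -tens_split2 comp_assoc alg_mul_unitr runit_nat.
rewrite tens_compr !comp_assoc.
by rewrite (comp_reassoc _ (runit_tens _ _ _)) -comp_assoc runit_invK comp_idr.
Qed.

Definition ext_unit_hom (X : rmodule R) :
    rmod_hom X (restrict (ext_ob coeqs all_coflat f X)) :=
  @RModHom C V R X (restrict (ext_ob coeqs all_coflat f X)) _ (ext_unit_lin X).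

Lemma ext_unit_nat (X Y : rmodule R) (h : rmod_hom X Y) :
  ext_map coeqs f h \o ext_unit X = ext_unit Y \o h.
Proof.
rewrite /ext_unit -[in RHS]comp_assoc runit_inv_nat !comp_assoc ext_mapE.
by congr (_ \o _); rewrite -!comp_assoc tens_interchange.
Qed.

(** By balancing, [y c ⊗ s = y ⊗ f(c) s = y ⊗ s]. It serves for [c = E(1)]. *)
Lemma ext_proj_mul_unit (Y : rmodule R) (c : hom I R) :
  f \o c = alg_unit S ->
  q Y \o ((rmod_act Y \o (idm Y ⊠ c) \o runit_inv V Y) ⊠ idm S) = q Y.
Proof.
move=> fc; rewrite !tens_compl !comp_assoc ext_proj_balancedE assoc_nat_reassoc.
rewrite !tens_fuse fc alg_mul_unitl.
rewrite -(comp_assoc (q Y)) triangle -comp_assoc -tens_compl.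
by rewrite runit_invK tens_id comp_idr.
Qed.

(** * From a bimodule map to a natural transformation on homs *)

Definition bimodule_map (E : hom S R) : Prop :=
  E \o alg_mul S \o (f ⊠ idm S) = alg_mul R \o (idm R ⊠ E) /\
  E \o alg_mul S \o (idm S ⊠ f) = alg_mul R \o (E ⊠ idm R).

Section Contraction.
Variables (E : hom S R) (HE : bimodule_map E).

(** Left linearity of [E] gives [(y r) E(s) = y E(f(r) s)], so [y ⊗ s |-> y E(s)] descends to
    [Y o_R S]. *)
Lemma contract_balanced (Y : rmodule R) (h := rmod_act Y \o (idm Y ⊠ E)) :
  h \o (rmod_act Y ⊠ idm S) =
  h \o ((idm Y ⊠ (alg_mul S \o (f ⊠ idm S))) \o assoc V Y R S).
Proof.
rewrite /h -(comp_assoc (rmod_act Y)) tens_interchange !comp_assoc rmod_mul.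
rewrite -tens_id assoc_nat_reassoc !tens_fuse.
by rewrite (comp_assoc E) (proj1 HE).
Qed.

Definition contract (Y : rmodule R) :
    hom (tens_over coeqs Y (restricted_lmodule f)) Y :=
  coeq_factor (ext_proj_coeq coeqs f Y) (contract_balanced Y).

Lemma contractE (Y : rmodule R) : contract Y \o q Y = rmod_act Y \o (idm Y ⊠ E).
Proof. exact: coeq_factorE. Qed.

(** Right linearity of [E] gives [y E(s f(r)) = (y E(s)) r]. *)
Lemma contract_lin (Y : rmodule R) :
  contract Y \o rmod_act (restrict (ext_ob coeqs all_coflat f Y)) =
  rmod_act Y \o (contract Y ⊠ idm R).
Proof.
apply: (coeq_epi (ext_proj_tens_coeq coeqs all_coflat f Y R)).
rewrite /= comp_assoc !tens_fuse contractE -(tens_split1 _ (q Y)) comp_assoc.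
rewrite (comp_reassoc _ (ext_actE _ _ _ _)) !comp_assoc contractE.
rewrite -tens_id assoc_nat_reassoc !tens_fuse /= (comp_assoc E) (proj2 HE).
by rewrite tens_compl comp_assoc rmod_mul assoc_nat_reassoc !tens_fuse.
Qed.

Definition contract_hom (Y : rmodule R) :
    rmod_hom (restrict (ext_ob coeqs all_coflat f Y)) Y :=
  @RModHom C V R (restrict (ext_ob coeqs all_coflat f Y)) Y _ (contract_lin Y).

Lemma contract_nat (X Y : rmodule R) (h : rmod_hom X Y) :
  contract Y \o ext_map coeqs f h = h \o contract X.
Proof.
apply: (coeq_epi (ext_proj_coeq coeqs f X)).
rewrite -!comp_assoc ext_mapE contractE !comp_assoc contractE rmod_map_lin.
by rewrite -!comp_assoc tens_interchange.
Qed.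

Lemma contract_unit (Y : rmodule R) :
  contract Y \o ext_unit Y =
  rmod_act Y \o (idm Y ⊠ (E \o alg_unit S)) \o runit_inv V Y.
Proof. by rewrite /ext_unit !comp_assoc contractE !tens_fuse. Qed.

(** By balancing, [y E(s) ⊗ t = y ⊗ f(E(s)) t = y ⊗ s t]. *)
Lemma ext_proj_contract (Y : rmodule R) :
  f \o E = idm S ->
  q Y \o (contract Y ⊠ idm S) = ext_act coeqs all_coflat f Y.
Proof.
move=> fE; apply: (coeq_epi (ext_proj_tens_coeq coeqs all_coflat f Y S)).
rewrite tens_fuse ext_actE contractE !tens_fuse tens_compl comp_assoc.
rewrite ext_proj_balancedE assoc_nat_reassoc !tens_fuse.
by rewrite fE tens_id comp_idr.
Qed.

Definition retract_hom (X Y : rmodules R) (g : hom (F X) (F Y)) : hom X Y :=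
  rmod_comp (contract_hom Y) (rmod_comp (restrict_hom g) (ext_unit_hom X)).

Lemma retract_hom_nat : natural_on_homs retract_hom.
Proof.
move=> X X' Y Y' h k g; apply: rmod_hom_eq => /=.
rewrite -!comp_assoc ext_unit_nat !comp_assoc.
by rewrite contract_nat.
Qed.

(** The retraction sends [f^*(h)] to [x |-> h(x) E(1)], so what remains is a condition on [E(1)]. *)
Lemma retract_fmap (X Y : rmodules R) (h : hom X Y) :
  rmod_map (retract_hom (fmap F h)) =
  rmod_act Y \o (idm (rmod_ob Y) ⊠ (E \o alg_unit S)) \o runit_inv V (rmod_ob Y)
    \o rmod_map h.
Proof. by rewrite /= ext_unit_nat comp_assoc contract_unit. Qed.

End Contraction.

Lemma bimodule_map_semiseparable (E : hom S R) :
  bimodule_map E -> f \o E \o f = f -> semiseparable F.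
Proof.
move=> HE fEf; exists (retract_hom HE); split; first exact: retract_hom_nat.
move=> X Y h; apply: rmod_hom_eq; apply: (coeq_epi (ext_proj_coeq coeqs f X)).
rewrite /= !ext_mapE (retract_fmap HE h) tens_compl comp_assoc.
(* Here [f(E(1)) = f(E(f(1))) = f(1) = 1], so [E(1)] is absorbed by the tensor product over [R]. *)
rewrite ext_proj_mul_unit // -(alg_map_unit f).
by rewrite !comp_assoc fEf.
Qed.

Lemma bimodule_map_separable (E : hom S R) :
  bimodule_map E -> E \o f = idm R -> separable F.
Proof.
move=> HE Ef; exists (retract_hom HE); split; first exact: retract_hom_nat.
move=> X Y h; apply: rmod_hom_eq.
rewrite (retract_fmap HE h) -(alg_map_unit f) (comp_assoc E) Ef comp_idl.
by rewrite rmod_unit runit_invK comp_idl.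
Qed.

Lemma bimodule_map_naturally_full (E : hom S R) :
  bimodule_map E -> f \o E = idm S -> naturally_full F.
Proof.
move=> HE fE; exists (retract_hom HE); split; first exact: retract_hom_nat.
move=> X Y g; apply: rmod_hom_eq; apply: (coeq_epi (ext_proj_coeq coeqs f X)).
(* In elements, [contract (g (x ⊗ 1)) ⊗ s = g (x ⊗ 1) s = g (x ⊗ s)], by [f E = id] and the
   linearity of [g]. *)
rewrite /= ext_mapE /= 2!tens_compl !comp_assoc ext_proj_contract //.
rewrite -(rmod_map_lin g) /= -comp_assoc.
by rewrite ext_act_unitl.
Qed.

(** * The isomorphism between [S] and [f^*(R) = R o_R S] *)

Lemma alg_act_section :
  alg_mul S \o (f ⊠ idm S) \o ((alg_unit R ⊠ idm S) \o lunit_inv V S) = idm S.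
Proof.
by rewrite comp_assoc !tens_fuse alg_map_unit alg_mul_unitl lunit_invK.
Qed.

(** The map [s |-> 1 ⊗ s], inverse to the map [R o_R S -> S] induced by the left action. *)
Definition ext_regular_inv :
    hom S (tens_over coeqs (regular_rmodule R) (restricted_lmodule f)) :=
  q (regular_rmodule R) \o (alg_unit R ⊠ idm S) \o lunit_inv V S.

(** By balancing, [1 ⊗ f(r) s = r ⊗ s]. *)
Lemma ext_regular_invE :
  ext_regular_inv \o (alg_mul S \o (f ⊠ idm S)) = q (regular_rmodule R).
Proof.
rewrite /ext_regular_inv -comp_assoc lunit_inv_nat comp_assoc.
rewrite -(comp_assoc (q _)) -tens_interchange comp_assoc.
rewrite -lunit_inv_tens comp_assoc -tens_id -(comp_assoc _ _ (assoc _ _ _ _)).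
rewrite -assoc_nat comp_assoc -ext_proj_balancedE !tens_fuse /= !comp_assoc alg_mul_unitl.
by rewrite lunit_invK tens_id comp_idr.
Qed.

Lemma ext_regular_inv_lin :
  ext_act coeqs all_coflat f (regular_rmodule R) \o (ext_regular_inv ⊠ idm S) =
  ext_regular_inv \o alg_mul S.
Proof.
rewrite /ext_regular_inv !tens_compl !comp_assoc ext_actE assoc_nat_reassoc.
rewrite -comp_assoc lunit_inv_tens -[in RHS]comp_assoc lunit_inv_nat.
by rewrite comp_assoc !tens_fuse tens_id comp_idr.
Qed.

Lemma alg_map_left_mul (e : hom I R) :
  f \o left_mul e = left_mul (f \o e) \o f.
Proof.
apply: (split_epi (lunit_invK V R)).
rewrite -(comp_assoc (alg_map f)) left_mulE -(comp_assoc (left_mul _)) -lunit_nat.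
rewrite (comp_assoc (left_mul _)) left_mulE tens_fuse (comp_assoc (alg_map f)).
by rewrite alg_map_mul !tens_fuse.
Qed.

Lemma ext_regular_inv_left_mul (e : hom I R) :
  ext_map coeqs f (left_mul_hom e) \o ext_regular_inv =
  ext_regular_inv \o left_mul (f \o e).
Proof.
(* The left action [R ⊗ S -> S] is a split epimorphism; precomposed with it, the claim reduces to
   [f(e r) = f(e) f(r)]. *)
apply: (split_epi alg_act_section).
rewrite -(comp_assoc (ext_map _ _ _)) ext_regular_invE.
rewrite (ext_mapE coeqs f (left_mul_hom e)) /= -ext_regular_invE.
rewrite -!(comp_assoc ext_regular_inv); congr (_ \o _).
by rewrite !tens_fuse alg_map_left_mul comp_assoc left_mul_lin !tens_fuse.
Qed.

(** The left action on [S] is balanced and factors through [R o_R S]; the factor [k] is a left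
    inverse. *)
Lemma ext_regular_inv_mono (X : C) (g h : hom X S) :
  ext_regular_inv \o g = ext_regular_inv \o h -> g = h.
Proof.
have [|k kq] := @balanced_proj (regular_rmodule R) S (alg_mul S \o (f ⊠ idm S)).
  exact: (lmod_mul (restricted_lmodule f)).
have kj : k \o ext_regular_inv = idm S.
  by rewrite /ext_regular_inv -(comp_assoc (q _)) comp_assoc kq alg_act_section.
by move=> E; rewrite -(comp_idl g) -(comp_idl h) -kj -2!(comp_assoc k) E.
Qed.

(** * The multiplication of [S] as a map from [f^*(S)] to [f^*(R)] *)

Lemma alg_map_lin :
  alg_map f \o rmod_act (regular_rmodule R) =
  rmod_act (restrict (regular_rmodule S)) \o (f ⊠ idm R).
Proof. by rewrite /= !tens_fuse alg_map_mul. Qed.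

Definition alg_map_hom :
    rmod_hom (regular_rmodule R) (restrict (regular_rmodule S)) :=
  @RModHom C V R (regular_rmodule R) (restrict (regular_rmodule S)) _ alg_map_lin.

(** The map [s ⊗ t |-> 1 ⊗ s t] descends because [(s f(r)) t = s (f(r) t)], and associativity makes
    it [S]-linear. *)
Lemma ext_mul_exists :
  exists g : hom (F (restrict (regular_rmodule S))) (F (regular_rmodule R)),
    rmod_map g \o q (restrict (regular_rmodule S)) = ext_regular_inv \o alg_mul S.
Proof.
have [|g0 g0q] := @balanced_proj (restrict (regular_rmodule S)) _
  (ext_regular_inv \o alg_mul S).
  rewrite /= -!(comp_assoc ext_regular_inv); congr (_ \o _).
  rewrite tens_compl !comp_assoc alg_mul_assoc assoc_nat_reassoc.
  by rewrite !tens_fuse.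
have g0lin : g0 \o rmod_act (F (restrict (regular_rmodule S))) =
    rmod_act (F (regular_rmodule R)) \o (g0 ⊠ idm S).
  apply: (coeq_epi (ext_proj_tens_coeq coeqs all_coflat f _ S)).
  rewrite /= (comp_reassoc _ (ext_actE _ _ _ (restrict (regular_rmodule S)))).
  rewrite !comp_assoc g0q.
  rewrite -[in RHS]comp_assoc -tens_compl g0q tens_compl comp_assoc.
  rewrite ext_regular_inv_lin.
  by rewrite -(comp_assoc ext_regular_inv) alg_mul_assoc !comp_assoc.
by exists (@RModHom C V S (F (restrict (regular_rmodule S)))
  (F (regular_rmodule R)) g0 g0lin).
Qed.

Section Multiplication.
Variable g : hom (F (restrict (regular_rmodule S))) (F (regular_rmodule R)).
Hypothesis gE :
  rmod_map g \o q (restrict (regular_rmodule S)) = ext_regular_inv \o alg_mul S.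

(** In elements, [g (f(r) ⊗ s) = 1 ⊗ f(r) s = r ⊗ s]. *)
Lemma ext_mul_alg_map : g \o fmap F alg_map_hom = idm (F (regular_rmodule R)).
Proof.
apply: rmod_hom_eq; apply: (coeq_epi (ext_proj_coeq coeqs f (regular_rmodule R))).
rewrite /= -(comp_assoc (rmod_map g)) (ext_mapE coeqs f alg_map_hom) comp_assoc gE comp_idl.
by rewrite -(comp_assoc ext_regular_inv) ext_regular_invE.
Qed.

(** This is [f(e) (s t) = (f(e) s) t], carried over to [R o_R S]. *)
Lemma ext_mul_left_mul (e : hom I R) :
  fmap F (left_mul_hom e) \o g =
  g \o fmap F (restrict_hom (left_mul_hom (f \o e))).
Proof.
apply: rmod_hom_eq.
apply: (coeq_epi (ext_proj_coeq coeqs f (restrict (regular_rmodule S)))).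
rewrite /= -(comp_assoc (ext_map _ _ _)) gE -(comp_assoc (rmod_map g)).
rewrite (ext_mapE coeqs f (restrict_hom (left_mul_hom (f \o e)))).
rewrite (comp_assoc (rmod_map g)) gE /= -[in RHS](comp_assoc ext_regular_inv).
rewrite -left_mul_lin (comp_assoc (ext_map _ _ _)) ext_regular_inv_left_mul.
by rewrite -[in LHS](comp_assoc ext_regular_inv).
Qed.

Lemma natural_bimodule_map
    (P : forall X Y : rmodules R, hom (F X) (F Y) -> hom X Y) :
  unit_left_generator V -> natural_on_homs P -> bimodule_map (rmod_map (P _ _ g)).
Proof.
move=> gen Pnat; split; last first.
  by rewrite -comp_assoc; exact: (rmod_map_lin (P _ _ g)).
(* Left linearity equates two maps out of [R ⊗ S], so it may be tested on [e : I -> R]. *)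
apply: gen => e.
(* Naturality in the target and in the source, applied to the two sides of [ext_mul_left_mul], gives
   [e E(s) = E(f(e) s)]. *)
have := Pnat _ _ _ _ (idm _) (left_mul_hom e) g.
rewrite fmap_id !comp_idr ext_mul_left_mul => PL.
have PR := Pnat _ _ _ _ (restrict_hom (left_mul_hom (f \o e))) (idm _) g.
rewrite fmap_id !comp_idl in PR.
have {PL PR}/(f_equal (@rmod_map C V R _ _)) /= E := eq_trans (eq_sym PL) PR.
rewrite !tens_fuse -(comp_assoc _ (alg_mul S)) -left_mulE comp_assoc.
rewrite -E -tens_split1 comp_assoc -left_mulE.
by rewrite -!comp_assoc lunit_nat.
Qed.

(** Naturality in the source along [f], since [g] composed with [f^*(f)] is the identity. *)
Lemma natural_alg_map (P : forall X Y : rmodules R, hom (F X) (F Y) -> hom X Y) :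
  natural_on_homs P -> P _ _ g \o alg_map_hom = P _ _ (fmap F (idm _)).
Proof.
move=> Pnat; have := Pnat _ _ _ _ alg_map_hom (idm _) g.
by rewrite fmap_id -comp_assoc ext_mul_alg_map !comp_idl => <-.
Qed.

End Multiplication.

Lemma semiseparable_bimodule_map :
  unit_left_generator V -> semiseparable F ->
  exists E : hom S R, bimodule_map E /\ f \o E \o f = f.
Proof.
move=> gen [P [Pnat PF]]; have [g gE] := ext_mul_exists.
exists (rmod_map (P _ _ g)); split; first exact: natural_bimodule_map.
(* At the identity of [R] the hypothesis says that [f^*(E f)] is the identity; read in [S], this is
   [f(E(f(r))) s = f(r) s]. *)
have /(f_equal (@rmod_map C V S _ _)) := PF _ _ (idm (regular_rmodule R : rmodules R)).
rewrite -(natural_alg_map gE Pnat) fmap_id /=.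
move/(f_equal (fun k => k \o q (regular_rmodule R))).
rewrite ext_mapE comp_idl -ext_regular_invE /= -(comp_assoc ext_regular_inv).
move/ext_regular_inv_mono; rewrite !tens_fuse comp_assoc.
exact: alg_mul_faithful.
Qed.

Lemma naturally_full_bimodule_map :
  unit_left_generator V -> naturally_full F ->
  exists E : hom S R, bimodule_map E /\ f \o E = idm S.
Proof.
move=> gen [P [Pnat PF]]; have [g gE] := ext_mul_exists.
exists (rmod_map (P _ _ g)); split; first exact: natural_bimodule_map.
(* Read in [S], the equation [f^*(P g) = g] becomes [f(E(s)) t = s t]. *)
have /(f_equal (@rmod_map C V S _ _)) := PF _ _ g.
move/(f_equal (fun k => k \o q (restrict (regular_rmodule S)))).
rewrite gE /= (ext_mapE coeqs f (P _ _ g)) -ext_regular_invE /=.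
rewrite -(comp_assoc ext_regular_inv) => /ext_regular_inv_mono E.
by apply: alg_mul_faithful; rewrite tens_id comp_idr -[RHS]E !tens_fuse.
Qed.

Lemma separable_bimodule_map :
  unit_left_generator V -> separable F ->
  exists E : hom S R, bimodule_map E /\ E \o f = idm R.
Proof.
move=> gen [P [Pnat PF]]; have [g gE] := ext_mul_exists.
exists (rmod_map (P _ _ g)); split; first exact: natural_bimodule_map.
have /(f_equal (@rmod_map C V R _ _)) := natural_alg_map gE Pnat.
by rewrite PF.
Qed.

End Extension.

(** * Passage to bullet products *)

Lemma bullet_bimodule_map (C : category) (Vo Vb : monoidal C) (D : duoidal Vo Vb)
    (R1 S1 R2 S2 : algebra Vo) (f1 : alg_hom R1 S1) (f2 : alg_hom R2 S2)
    (E1 : hom S1 R1) (E2 : hom S2 R2) :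
  bimodule_map f1 E1 -> bimodule_map f2 E2 ->
  bimodule_map (bullet_alg_hom D f1 f2) (tens_hom Vb E1 E2).
Proof.
(* Splitting identities into bullet products of identities lets [zeta_nat] apply; both equations
   then hold factor by factor. *)
move=> [l1 r1] [l2 r2]; split; rewrite /= /bullet_mul -!(tens_id Vb).
  rewrite comp_assoc -tens_comp -!comp_assoc !zeta_nat !comp_assoc -!tens_comp.
  by rewrite l1 l2.
rewrite comp_assoc -tens_comp -!comp_assoc !zeta_nat !comp_assoc -!tens_comp.
by rewrite r1 r2.
Qed.

Theorem proposition5p2
  (C : category) (Vo Vb : monoidal C) (D : duoidal Vo Vb)
  (coeqs : has_coequalizers C)
  (all_coflat : forall X : C, coflat Vo X)
  (I_generator : unit_left_generator Vo)
  (R1 S1 R2 S2 : algebra Vo) (f1 : alg_hom R1 S1) (f2 : alg_hom R2 S2) :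
  (semiseparable (extension_of_scalars coeqs all_coflat f1) ->
   semiseparable (extension_of_scalars coeqs all_coflat f2) ->
   semiseparable
     (extension_of_scalars coeqs all_coflat (bullet_alg_hom D f1 f2)))
  /\
  (separable (extension_of_scalars coeqs all_coflat f1) ->
   separable (extension_of_scalars coeqs all_coflat f2) ->
   separable
     (extension_of_scalars coeqs all_coflat (bullet_alg_hom D f1 f2)))
  /\
  (naturally_full (extension_of_scalars coeqs all_coflat f1) ->
   naturally_full (extension_of_scalars coeqs all_coflat f2) ->
   naturally_full
     (extension_of_scalars coeqs all_coflat (bullet_alg_hom D f1 f2))).
Proof.
split; [|split].
(* In all three cases [E1 • E2] is the required map, its identity with [f1 • f2] following from
   functoriality of the bullet product. *)
- move=> /(semiseparable_bimodule_map I_generator) [E1 [b1 s1]].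
  move=> /(semiseparable_bimodule_map I_generator) [E2 [b2 s2]].
  apply: (bimodule_map_semiseparable _ _ (bullet_bimodule_map D b1 b2)).
  by rewrite /= -!tens_comp s1 s2.
- move=> /(separable_bimodule_map I_generator) [E1 [b1 s1]].
  move=> /(separable_bimodule_map I_generator) [E2 [b2 s2]].
  apply: (bimodule_map_separable _ _ (bullet_bimodule_map D b1 b2)).
  by rewrite /= -!tens_comp s1 s2 tens_id.
- move=> /(naturally_full_bimodule_map I_generator) [E1 [b1 s1]].
  move=> /(naturally_full_bimodule_map I_generator) [E2 [b2 s2]].
  apply: (bimodule_map_naturally_full _ _ (bullet_bimodule_map D b1 b2)).
  by rewrite /= -!tens_comp s1 s2 tens_id.
Qed.
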